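(* The dagger category $\mathrm{TRel}(\mathbf{JSL},\mathrm{cp})$ of tame relations for the symmetric comparison cluster $\mathrm{cp}_X\colon\mathcal{P}_{\mathrm{fin}}(X)\otimes\mathcal{P}_{\mathrm{fin}}(X)\to 2$ in $\mathbf{JSL}$, indexed by sets $X$ and determined by $\mathrm{cp}_X(U\otimes U')=1$ iff $U\cap U'\neq\emptyset$, is the category $\mathbf{BifRel}$ of sets with bifinite relations between them, i.e. with as morphisms $X\to Y$ those relations $r\subseteq X\times Y$ where for each $x\in X$ and $y\in Y$ both the sets $$\{z\in Y\mid r(x,z)\}\qquad\text{and}\qquad\{w\in X\mid r(w,y)\}$$ are finite. Such a relation factors in two directions, as $X\to\mathcal{P}_{\mathrm{fin}}(Y)$ and as $Y\to\mathcal{P}_{\mathrm{fin}}(X)$.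
   Context: $\mathbf{JSL}$ is the category of join semilattices (posets with all finite joins, including a bottom element) and maps preserving finite joins, with trivial (identity) involution. Its tensor $\otimes$ classifies maps preserving finite joins in each argument separately. $\mathcal{P}_{\mathrm{fin}}(X)$ is the set of finite subsets of $X$, the free join semilattice on $X$; $2=\{0,1\}=\mathcal{P}_{\mathrm{fin}}(1)$ is the tensor unit, and $\mathcal{P}_{\mathrm{fin}}(X)\otimes\mathcal{P}_{\mathrm{fin}}(Y)\cong\mathcal{P}_{\mathrm{fin}}(X\times Y)$. Hence relations (maps) $\widehat r\colon\mathcal{P}_{\mathrm{fin}}(X)\otimes\mathcal{P}_{\mathrm{fin}}(Y)\to 2$ in $\mathbf{JSL}$ correspond bijectively to ordinary relations $r\subseteq X\times Y$, via $\widehat r(U\otimes V)=1$ iff $r(x,y)$ for some $x\in U,y\in V$. $\mathrm{TRel}(\mathbf{JSL},\mathrm{cp})$ has sets as objects. Morphisms $X\to Y$ are tame relations: maps $r\colon\mathcal{P}_{\mathrm{fin}}(X)\otimes\mathcal{P}_{\mathrm{fin}}(Y)\to 2$ in $\mathbf{JSL}$ for which there are (necessarily unique) $\mathbf{JSL}$-maps $r_*\colon\mathcal{P}_{\mathrm{fin}}(X)\to\mathcal{P}_{\mathrm{fin}}(Y)$ and $r^*\colon\mathcal{P}_{\mathrm{fin}}(Y)\to\mathcal{P}_{\mathrm{fin}}(X)$ with $\mathrm{cp}_Y\circ(r_*\otimes\mathrm{id})=r=\mathrm{cp}_X\circ(\mathrm{id}\otimes r^* )$. Identities are the $\mathrm{cp}_X$,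 composition is $s\bullet r=s\circ(r_*\otimes\mathrm{id})$, and the dagger is $r^\dagger=\mathrm{cp}_X\circ(r^*\otimes\mathrm{id})$. In $\mathbf{BifRel}$ identities are equality relations, composition is relational composition and the dagger is relational converse. ''Is'' means isomorphic as dagger categories, identically on objects, via the correspondence $r\leftrightarrow\widehat r$. *)

(* Defs.v *)
From HB Require Import structures.
From mathcomp Require Import all_boot all_order finmap.
From mathcomp Require Import boolp classical_sets functions cardinality.

Set Implicit Arguments.
Unset Strict Implicit.
Unset Printing Implicit Defensive.

Local Obligation Tactic := intros.

Import Order.Theory.
Local Open Scope classical_set_scope.
Local Open Scope quotient_scope.
Local Open Scope order_scope.

(* Objects of JSL are bJoinSemilatticeTypes; preserving finite joins amounts to
   preserving \bot and binary joins. *)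
Record jhom d d' (A : bJoinSemilatticeType d) (B : bJoinSemilatticeType d') :=
  JHom {
    jfun :> A -> B;
    jhom0 : jfun \bot = \bot;
    jhomU : forall x y, jfun (x `|` y) = jfun x `|` jfun y }.

Lemma jhomP d d' (A : bJoinSemilatticeType d) (B : bJoinSemilatticeType d')
  (f g : jhom A B) : (forall x, f x = g x) -> f = g.
Proof.
case: f g => [f f0 fU] [g g0 gU] /= /funext fg.
by subst g; congr JHom; exact: Prop_irrelevance.
Qed.

Program Definition jid d (A : bJoinSemilatticeType d) : jhom A A :=
  @JHom _ _ A A id _ _.
Next Obligation. by []. Qed.
Next Obligation. by []. Qed.

Program Definition jcomp d d' d'' (A : bJoinSemilatticeType d)
  (B : bJoinSemilatticeType d') (C : bJoinSemilatticeType d'')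
  (g : jhom B C) (f : jhom A B) : jhom A C := @JHom _ _ A C (g \o f) _ _.
Next Obligation. by rewrite /= !jhom0. Qed.
Next Obligation. by rewrite /= !jhomU. Qed.

Lemma jcompE d d' d'' (A : bJoinSemilatticeType d)
  (B : bJoinSemilatticeType d') (C : bJoinSemilatticeType d'')
  (g : jhom B C) (f : jhom A B) x : jcomp g f x = g (f x).
Proof. by []. Qed.

Lemma jidE d (A : bJoinSemilatticeType d) (x : A) : jid A x = x.
Proof. by []. Qed.

Record bihom d1 d2 d3 (A : bJoinSemilatticeType d1)
  (B : bJoinSemilatticeType d2) (C : bJoinSemilatticeType d3) := BiHom {
    bifun :> A -> B -> C;
    bihom0l : forall b, bifun \bot b = \bot;
    bihom0r : forall a, bifun a \bot = \bot;
    bihomUl : forall a a' b, bifun (a `|` a') b = bifun a b `|` bifun a' b;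
    bihomUr : forall a b b', bifun a (b `|` b') = bifun a b `|` bifun a b' }.

(* The tensor product is presented by generators and relations: formal finite
   joins of pure tensors, modulo the join semilattice axioms and bilinearity.
   It classifies bihoms, see tens_universal below. *)
Inductive tens_term (A B : Type) : Type :=
| TBot
| TPure of A & B
| TJoin of tens_term A B & tens_term A B.
Arguments TBot {A B}.

Inductive tens_eq d1 d2 (A : bJoinSemilatticeType d1)
    (B : bJoinSemilatticeType d2) : tens_term A B -> tens_term A B -> Prop :=
| teq_refl s : tens_eq s s
| teq_sym s t : tens_eq s t -> tens_eq t s
| teq_trans s t u : tens_eq s t -> tens_eq t u -> tens_eq s u
| teq_join s s' t t' :
    tens_eq s s' -> tens_eq t t' -> tens_eq (TJoin s t) (TJoin s' t')
| teq_joinA s t u : tens_eq (TJoin s (TJoin t u)) (TJoin (TJoin s t) u)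
| teq_joinC s t : tens_eq (TJoin s t) (TJoin t s)
| teq_joinI s : tens_eq (TJoin s s) s
| teq_join0 s : tens_eq (TJoin TBot s) s
| teq_pure0l b : tens_eq (TPure \bot b) TBot
| teq_pure0r a : tens_eq (TPure a \bot) TBot
| teq_pureUl a a' b :
    tens_eq (TPure (a `|` a') b) (TJoin (TPure a b) (TPure a' b))
| teq_pureUr a b b' :
    tens_eq (TPure a (b `|` b')) (TJoin (TPure a b) (TPure a b')).

Fact tens_display : Order.disp_t. Proof. exact: Order.Disp tt tt. Qed.

Section Tensor.
Variables (d1 d2 : Order.disp_t).
Variables (A : bJoinSemilatticeType d1) (B : bJoinSemilatticeType d2).

Definition tens_eqb : rel {classic (tens_term A B)} :=
  fun s t => `[< tens_eq (A := A) (B := B) s t >].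

Lemma tens_eqb_refl : reflexive tens_eqb.
Proof. by move=> s; apply/asboolP; exact: teq_refl. Qed.

Lemma tens_eqb_sym : symmetric tens_eqb.
Proof. by move=> s t; apply/asboolP/asboolP; exact: teq_sym. Qed.

Lemma tens_eqb_trans : transitive tens_eqb.
Proof.
by move=> t s u /asboolP st /asboolP tu; apply/asboolP; exact: teq_trans st tu.
Qed.

Canonical tens_equiv :=
  EquivRel tens_eqb tens_eqb_refl tens_eqb_sym tens_eqb_trans.

Definition tens := {eq_quot tens_equiv}.

HB.instance Definition _ := Choice.on tens.

Definition tens_pi (s : tens_term A B) : tens :=
  \pi_({eq_quot tens_equiv}) (s : {classic (tens_term A B)}).

Lemma tens_piP s t : tens_eq s t <-> tens_pi s = tens_pi t.
Proof.
split=> [st|/eqmodP/asboolP //].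
by apply/eqmodP/asboolP.
Qed.

Lemma tens_ind (P : tens -> Prop) : (forall s, P (tens_pi s)) -> forall x, P x.
Proof. by move=> Ppi x; rewrite -[x]reprK; exact: Ppi. Qed.

Definition tens_join (x y : tens) : tens := tens_pi (TJoin (repr x) (repr y)).

Lemma tens_pi_repr (x : tens) : tens_pi (repr x) = x.
Proof. exact: reprK. Qed.

Lemma tens_joinE s t : tens_join (tens_pi s) (tens_pi t) = tens_pi (TJoin s t).
Proof.
by apply/tens_piP/teq_join; apply/tens_piP; rewrite tens_pi_repr.
Qed.

Lemma tens_joinA : associative tens_join.
Proof.
elim/tens_ind=> s; elim/tens_ind=> t; elim/tens_ind=> u.
by rewrite !tens_joinE; apply/tens_piP/teq_joinA.
Qed.

Lemma tens_joinC : commutative tens_join.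
Proof.
elim/tens_ind=> s; elim/tens_ind=> t.
by rewrite !tens_joinE; apply/tens_piP/teq_joinC.
Qed.

Lemma tens_joinxx x : tens_join x x = x.
Proof. by elim/tens_ind: x => s; rewrite tens_joinE; apply/tens_piP/teq_joinI. Qed.

Definition tens_le (x y : tens) : bool := tens_join y x == y.

Lemma tens_le_refl : reflexive tens_le.
Proof. by move=> x; rewrite /tens_le tens_joinxx. Qed.

Lemma tens_le_anti : antisymmetric tens_le.
Proof. by move=> x y /andP[/eqP xy /eqP]; rewrite tens_joinC xy. Qed.

Lemma tens_le_trans : transitive tens_le.
Proof.
move=> y x z /eqP yx /eqP zy; apply/eqP.
by rewrite -zy -tens_joinA yx.
Qed.

HB.instance Definition _ := Order.Le_isPOrder.Build tens_display tens
  tens_le_refl tens_le_anti tens_le_trans.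

Lemma tens_leEjoin (x y : tens) : (y <= x) = (tens_join x y == x).
Proof. by []. Qed.

HB.instance Definition _ := Order.POrder_Join_isSemilattice.Build tens_display
  tens tens_joinC tens_joinA tens_leEjoin.

Lemma tens_le0x (x : tens) : tens_pi TBot <= x.
Proof.
elim/tens_ind: x => s; rewrite tens_leEjoin tens_joinC tens_joinE; apply/eqP.
exact/tens_piP/teq_join0.
Qed.

HB.instance Definition _ := Order.hasBottom.Build tens_display tens tens_le0x.

Program Definition pure : bihom A B tens :=
  @BiHom _ _ _ A B tens (fun a b => tens_pi (TPure a b)) _ _ _ _.
Next Obligation. exact/tens_piP/teq_pure0l. Qed.
Next Obligation. exact/tens_piP/teq_pure0r. Qed.
Next Obligation.
by rewrite [RHS]tens_joinE; exact/tens_piP/teq_pureUl.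
Qed.
Next Obligation.
by rewrite [RHS]tens_joinE; exact/tens_piP/teq_pureUr.
Qed.

Section Lift.
Variables (d3 : Order.disp_t) (C : bJoinSemilatticeType d3) (f : bihom A B C).

Fixpoint term_lift (s : tens_term A B) : C :=
  match s with
  | TBot => \bot
  | TPure a b => f a b
  | TJoin s t => term_lift s `|` term_lift t
  end.

Lemma term_lift_eq s t : tens_eq s t -> term_lift s = term_lift t.
Proof.
elim=> //= {s t} [s t u _ -> _ -> //|s s' t t' _ -> _ -> //|s t u|s t|s|s||||].
- exact: joinA.
- exact: joinC.
- exact: joinxx.
- exact: join0x.
- exact: bihom0l.
- exact: bihom0r.
- exact: bihomUl.
- exact: bihomUr.
Qed.

Lemma term_lift_repr s : term_lift (repr (tens_pi s)) = term_lift s.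
Proof. by apply: term_lift_eq; apply/tens_piP; rewrite tens_pi_repr. Qed.

Program Definition tens_lift : jhom tens C :=
  @JHom _ _ tens C (fun x : tens => term_lift (repr x)) _ _.
Next Obligation. exact: term_lift_repr TBot. Qed.
Next Obligation. exact: term_lift_repr (TJoin (repr x) (repr y)). Qed.

Lemma tens_liftE a b : tens_lift (pure a b) = f a b.
Proof. exact: term_lift_repr (TPure a b). Qed.

End Lift.

Lemma tens_homP d3 (C : bJoinSemilatticeType d3) (f g : jhom tens C) :
  (forall a b, f (pure a b) = g (pure a b)) -> f = g.
Proof.
move=> fg; apply: jhomP; elim/tens_ind; elim=> [|a b|s IHs t IHt].
- by rewrite -[tens_pi TBot]/(\bot : tens) !jhom0.
- exact: fg.
- have -> : tens_pi (TJoin s t) = tens_pi s `|` tens_pi t.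
    by rewrite -tens_joinE.
  by rewrite !jhomU IHs IHt.
Qed.

End Tensor.

Notation "A ⊗ B" := (tens A B) (at level 40, left associativity) : type_scope.

Lemma tens_universal d1 d2 d3 (A : bJoinSemilatticeType d1)
  (B : bJoinSemilatticeType d2) (C : bJoinSemilatticeType d3)
  (f : bihom A B C) :
  exists! h : jhom (A ⊗ B) C, forall a b, h (pure A B a b) = f a b.
Proof.
exists (tens_lift f); split=> [a b|h hf]; first exact: tens_liftE.
by apply: tens_homP => a b; rewrite tens_liftE hf.
Qed.

Program Definition tens_map_bihom d1 d2 d3 d4 (A : bJoinSemilatticeType d1)
  (B : bJoinSemilatticeType d2) (A' : bJoinSemilatticeType d3)
  (B' : bJoinSemilatticeType d4) (f : jhom A A') (g : jhom B B') :
  bihom A B (A' ⊗ B') :=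
  @BiHom _ _ _ A B (A' ⊗ B') (fun a b => pure A' B' (f a) (g b)) _ _ _ _.
Next Obligation. cbv beta; by rewrite jhom0 bihom0l. Qed.
Next Obligation. cbv beta; by rewrite jhom0 bihom0r. Qed.
Next Obligation. cbv beta; by rewrite jhomU bihomUl. Qed.
Next Obligation. cbv beta; by rewrite jhomU bihomUr. Qed.

Definition tens_map d1 d2 d3 d4 (A : bJoinSemilatticeType d1)
  (B : bJoinSemilatticeType d2) (A' : bJoinSemilatticeType d3)
  (B' : bJoinSemilatticeType d4) (f : jhom A A') (g : jhom B B') :
  jhom (A ⊗ B) (A' ⊗ B') := tens_lift (tens_map_bihom f g).

Lemma tens_mapE d1 d2 d3 d4 (A : bJoinSemilatticeType d1)
  (B : bJoinSemilatticeType d2) (A' : bJoinSemilatticeType d3)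
  (B' : bJoinSemilatticeType d4) (f : jhom A A') (g : jhom B B') a b :
  tens_map f g (pure A B a b) = pure A' B' (f a) (g b).
Proof. exact: tens_liftE. Qed.

Program Definition swap_bihom d1 d2 (A : bJoinSemilatticeType d1)
  (B : bJoinSemilatticeType d2) : bihom A B (B ⊗ A) :=
  @BiHom _ _ _ A B (B ⊗ A) (fun a b => pure B A b a) _ _ _ _.
Next Obligation. cbv beta; by rewrite bihom0r. Qed.
Next Obligation. cbv beta; by rewrite bihom0l. Qed.
Next Obligation. cbv beta; by rewrite bihomUr. Qed.
Next Obligation. cbv beta; by rewrite bihomUl. Qed.

Definition tens_swap d1 d2 (A : bJoinSemilatticeType d1)
  (B : bJoinSemilatticeType d2) : jhom (A ⊗ B) (B ⊗ A) :=
  tens_lift (swap_bihom A B).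

Lemma tens_swapE d1 d2 (A : bJoinSemilatticeType d1)
  (B : bJoinSemilatticeType d2) a b :
  tens_swap A B (pure A B a b) = pure B A b a.
Proof. exact: tens_liftE. Qed.

Definition tensE := (jcompE, jidE, tens_mapE, tens_swapE).

(* The objects are a parameter, which makes functors that are the identity on
   objects expressible without casts. *)
Record dagger_cat (Ob : Type) := DaggerCat {
  hom :> Ob -> Ob -> Type;
  idm : forall X, hom X X;
  comp : forall X Y Z, hom Y Z -> hom X Y -> hom X Z;
  dag : forall X Y, hom X Y -> hom Y X;
  compA : forall X Y Z W (h : hom Z W) (g : hom Y Z) (f : hom X Y),
    comp h (comp g f) = comp (comp h g) f;
  comp1m : forall X Y (f : hom X Y), comp (idm Y) f = f;
  compm1 : forall X Y (f : hom X Y), comp f (idm X) = f;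
  dag1 : forall X, dag (idm X) = idm X;
  dag_comp : forall X Y Z (g : hom Y Z) (f : hom X Y),
    dag (comp g f) = comp (dag f) (dag g);
  dagK : forall X Y (f : hom X Y), dag (dag f) = f }.

Record dagger_functor (Ob : Type) (C D : dagger_cat Ob) := DaggerFunctor {
  fmap :> forall X Y, C X Y -> D X Y;
  fmap1 : forall X, fmap (idm C X) = idm D X;
  fmap_comp : forall X Y Z (g : C Y Z) (f : C X Y),
    fmap (comp g f) = comp (fmap g) (fmap f);
  fmap_dag : forall X Y (f : C X Y), fmap (dag f) = dag (fmap f) }.

(* The tensor unit 2 of JSL is bool, where false <= true.  Since the involution
   of JSL is trivial, symmetry is plain invariance under the swap map, and the
   nondegeneracy condition in the second argument follows from cp_inj. *)
Record cluster (d : Order.disp_t) (I : Type) := Cluster {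
  cl_obj :> I -> bJoinSemilatticeType d;
  cp : forall i, jhom (cl_obj i ⊗ cl_obj i) bool;
  cp_sym : forall i, jcomp (cp i) (tens_swap (cl_obj i) (cl_obj i)) = cp i;
  cp_inj : forall i d' (Z : bJoinSemilatticeType d') (f g : jhom Z (cl_obj i)),
    jcomp (cp i) (tens_map f (jid (cl_obj i))) =
    jcomp (cp i) (tens_map g (jid (cl_obj i))) -> f = g }.

Section TRel.
Variables (d : Order.disp_t) (I : Type) (K : cluster d I).

Definition tame (i j : I) (r : jhom (K i ⊗ K j) bool) : Prop :=
  exists (rl : jhom (K i) (K j)) (ru : jhom (K j) (K i)),
    jcomp (cp K j) (tens_map rl (jid (K j))) = r /\
    r = jcomp (cp K i) (tens_map (jid (K i)) ru).

Definition trel (i j : I) : Type := {r : jhom (K i ⊗ K j) bool | tame r}.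

Definition lower i j (r : trel i j) : jhom (K i) (K j) :=
  proj1_sig (cid (proj2_sig r)).

Definition upper i j (r : trel i j) : jhom (K j) (K i) :=
  proj1_sig (cid (proj2_sig (cid (proj2_sig r)))).

Lemma lowerE i j (r : trel i j) :
  jcomp (cp K j) (tens_map (lower r) (jid (K j))) = proj1_sig r.
Proof. by case: (proj2_sig (cid (proj2_sig (cid (proj2_sig r))))). Qed.

Lemma upperE i j (r : trel i j) :
  jcomp (cp K i) (tens_map (jid (K i)) (upper r)) = proj1_sig r.
Proof. by case: (proj2_sig (cid (proj2_sig (cid (proj2_sig r))))). Qed.

Lemma cp_symE i (a b : K i) :
  cp K i (pure _ _ a b) = cp K i (pure _ _ b a).
Proof. by rewrite -{1}cp_sym !tensE. Qed.

Lemma cp_lower i j (r : trel i j) a b :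
  cp K j (pure _ _ (lower r a) b) = proj1_sig r (pure _ _ a b).
Proof. by rewrite -lowerE !tensE. Qed.

Lemma cp_upper i j (r : trel i j) a b :
  cp K i (pure _ _ a (upper r b)) = proj1_sig r (pure _ _ a b).
Proof. by rewrite -upperE !tensE. Qed.

Lemma cp_injE i d' (Z : bJoinSemilatticeType d') (f g : jhom Z (K i)) :
  (forall z a, cp K i (pure _ _ (f z) a) = cp K i (pure _ _ (g z) a)) -> f = g.
Proof.
by move=> fg; apply: cp_inj; apply: tens_homP => z a; rewrite !tensE fg.
Qed.

Lemma lower_uniq i j (r : trel i j) (f : jhom (K i) (K j)) :
  jcomp (cp K j) (tens_map f (jid (K j))) = proj1_sig r -> f = lower r.
Proof. by move=> fr; apply: cp_inj; rewrite fr lowerE. Qed.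

Lemma upper_uniq i j (r : trel i j) (f : jhom (K j) (K i)) :
  jcomp (cp K i) (tens_map (jid (K i)) f) = proj1_sig r -> f = upper r.
Proof.
move=> fr; apply: cp_injE => z a.
by rewrite cp_symE [RHS]cp_symE cp_upper -fr !tensE.
Qed.

Lemma trelP i j (r s : trel i j) :
  (forall a b, proj1_sig r (pure _ _ a b) = proj1_sig s (pure _ _ a b)) -> r = s.
Proof.
move=> /tens_homP rs; case: r s rs => r hr [s hs] /= rs.
by subst s; congr exist; exact: Prop_irrelevance.
Qed.

Lemma tame_id i : tame (cp K i).
Proof.
by exists (jid _), (jid _); split; apply: tens_homP => a b; rewrite !tensE.
Qed.

Definition trel_id i : trel i i := exist _ (cp K i) (tame_id i).

Lemma tame_comp i j k (s : trel j k) (r : trel i j) :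
  tame (jcomp (proj1_sig s) (tens_map (lower r) (jid (K k)))).
Proof.
exists (jcomp (lower s) (lower r)), (jcomp (upper r) (upper s)).
split; apply: tens_homP => a b; rewrite !tensE.
  by rewrite cp_lower.
by rewrite (cp_upper r) -(cp_lower r) (cp_upper s).
Qed.

Definition trel_comp i j k (s : trel j k) (r : trel i j) : trel i k :=
  exist _ (jcomp (proj1_sig s) (tens_map (lower r) (jid (K k)))) (tame_comp s r).

Lemma tame_dag i j (r : trel i j) :
  tame (jcomp (cp K i) (tens_map (upper r) (jid (K i)))).
Proof.
exists (upper r), (lower r); split=> //.
apply: tens_homP => b a; rewrite !tensE.
by rewrite cp_symE cp_upper cp_symE cp_lower.
Qed.

Definition trel_dag i j (r : trel i j) : trel j i :=
  exist _ (jcomp (cp K i) (tens_map (upper r) (jid (K i)))) (tame_dag r).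

Lemma trel_compE i j k (s : trel j k) (r : trel i j) a c :
  proj1_sig (trel_comp s r) (pure _ _ a c) = proj1_sig s (pure _ _ (lower r a) c).
Proof. by rewrite !tensE. Qed.

Lemma trel_dagE i j (r : trel i j) a b :
  proj1_sig (trel_dag r) (pure _ _ b a) = proj1_sig r (pure _ _ a b).
Proof. by rewrite !tensE cp_symE cp_upper. Qed.

Lemma lower_comp i j k (s : trel j k) (r : trel i j) :
  lower (trel_comp s r) = jcomp (lower s) (lower r).
Proof.
by apply: cp_injE => a c; rewrite cp_lower trel_compE cp_lower.
Qed.

Lemma lower_id i : lower (trel_id i) = jid (K i).
Proof. by apply: cp_injE => a c; rewrite cp_lower. Qed.

Lemma lower_dag i j (r : trel i j) : lower (trel_dag r) = upper r.
Proof.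
by apply: cp_injE => b a; rewrite cp_lower trel_dagE cp_symE cp_upper.
Qed.

Program Definition TRel : dagger_cat I :=
  @DaggerCat I trel trel_id trel_comp trel_dag _ _ _ _ _ _.
Next Obligation.
by apply: trelP => a c; rewrite !trel_compE lower_comp.
Qed.
Next Obligation. by apply: trelP => a c; rewrite trel_compE cp_lower. Qed.
Next Obligation. by apply: trelP => a c; rewrite trel_compE lower_id. Qed.
Next Obligation. by apply: trelP => a c; rewrite trel_dagE /= cp_symE. Qed.
Next Obligation.
apply: trelP => c a; rewrite trel_dagE !trel_compE trel_dagE lower_dag.
by rewrite -cp_upper cp_lower.
Qed.
Next Obligation. by apply: trelP => a b; rewrite !trel_dagE. Qed.

End TRel.

Local Open Scope fset_scope.

(* {classic X} is X with its classical choiceType structure, so that the objects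
   can be all types. *)
Definition Pfin (X : Type) : Type := {fset {classic X}}.

HB.instance Definition _ X := Choice.copy (Pfin X) {fset {classic X}}.

Fact Pfin_display : Order.disp_t. Proof. exact: Order.Disp tt tt. Qed.

Section Pfin.
Variable X : Type.
Implicit Types U V : {fset {classic X}}.

Definition Pfin_le : rel (Pfin X) := @fsubset {classic X}.
Definition Pfin_join : Pfin X -> Pfin X -> Pfin X := @fsetU {classic X}.

Lemma Pfin_le_refl : reflexive Pfin_le.
Proof. exact: fsubset_refl. Qed.

Lemma Pfin_le_anti : antisymmetric Pfin_le.
Proof. by move=> U V UV; apply/eqP; rewrite eqEfsubset; exact: UV. Qed.

Lemma Pfin_le_trans : transitive Pfin_le.
Proof. exact: fsubset_trans. Qed.

HB.instance Definition _ := Order.Le_isPOrder.Build Pfin_display (Pfin X)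
  Pfin_le_refl Pfin_le_anti Pfin_le_trans.

Lemma Pfin_leUx (U V W : Pfin X) :
  (Pfin_join U V <= W)%O = (U <= W)%O && (V <= W)%O.
Proof. exact: fsubUset. Qed.

HB.instance Definition _ := Order.POrder_isJoinSemilattice.Build Pfin_display
  (Pfin X) Pfin_leUx.

Lemma Pfin_le0x (U : Pfin X) : ((fset0 : Pfin X) <= U)%O.
Proof. exact: fsub0set. Qed.

HB.instance Definition _ :=
  Order.hasBottom.Build Pfin_display (Pfin X) Pfin_le0x.

End Pfin.

(* hat r sends the pure tensor of U and V to 1 iff r meets U x V, see hatE. *)
Section Hat.
Variables (X Y : Type) (r : set (X * Y)).

Definition hat_fun (U : Pfin X) (V : Pfin Y) : bool :=
  `[< exists x y, [/\ x \in U, y \in V & r (x, y)] >].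

Lemma hat_funP (U : Pfin X) (V : Pfin Y) :
  reflect (exists x y, [/\ x \in U, y \in V & r (x, y)]) (hat_fun U V).
Proof. exact: asboolP. Qed.

Program Definition hat_bihom : bihom (Pfin X) (Pfin Y) bool :=
  @BiHom _ _ _ (Pfin X) (Pfin Y) bool hat_fun _ _ _ _.
Next Obligation. by apply/asboolPn => -[x [y []]]; rewrite inE. Qed.
Next Obligation. by apply/asboolPn => -[x [y []]]; rewrite inE. Qed.
Next Obligation.
rewrite [RHS]/(_ || _); apply/hat_funP/orP => [[x [y []]]|].
  by rewrite inE => /orP[xU|xU] yV rxy; [left|right]; apply/hat_funP; exists x, y.
by case=> /hat_funP[x [y [xU yV rxy]]]; exists x, y; split; rewrite // inE xU ?orbT.
Qed.
Next Obligation.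
rewrite [RHS]/(_ || _); apply/hat_funP/orP => [[x [y [xU]]]|].
  by rewrite inE => /orP[yV|yV] rxy; [left|right]; apply/hat_funP; exists x, y.
by case=> /hat_funP[x [y [xU yV rxy]]]; exists x, y; split; rewrite // inE yV ?orbT.
Qed.

Definition hat : jhom (Pfin X ⊗ Pfin Y) bool := tens_lift hat_bihom.

Lemma hatE (U : Pfin X) (V : Pfin Y) :
  hat (pure _ _ U V) <-> exists x y, [/\ x \in U, y \in V & r (x, y)].
Proof. by rewrite tens_liftE; split=> /asboolP. Qed.

End Hat.

Definition overlap (X : Type) (U U' : Pfin X) : bool := U `&` U' != fset0.

Lemma overlapP X (U U' : Pfin X) :
  reflect (exists2 x, x \in U & x \in U') (overlap U U').
Proof.
apply: (iffP (fset0Pn _)) => [[x]|[x xU xU']].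
  by rewrite inE => /andP[]; exists x.
by exists x; rewrite inE xU.
Qed.

Program Definition overlap_bihom X : bihom (Pfin X) (Pfin X) bool :=
  @BiHom _ _ _ (Pfin X) (Pfin X) bool (@overlap X) _ _ _ _.
Next Obligation. by apply/negbTE; rewrite negbK; apply/eqP/fset0I. Qed.
Next Obligation. by apply/negbTE; rewrite negbK; apply/eqP/fsetI0. Qed.
Next Obligation.
rewrite [RHS]/(_ || _); apply/overlapP/orP => [[x]|].
  rewrite inE => /orP[xU|xU] xU'; [left|right]; apply/overlapP; exists x => //.
by case=> /overlapP[x xU xU']; exists x => //; rewrite inE xU ?orbT.
Qed.
Next Obligation.
rewrite [RHS]/(_ || _); apply/overlapP/orP => [[x xU]|].
  rewrite inE => /orP[xU'|xU']; [left|right]; apply/overlapP; exists x => //.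
by case=> /overlapP[x xU xU']; exists x => //; rewrite inE xU' ?orbT.
Qed.

Definition Pfin_cp X : jhom (Pfin X ⊗ Pfin X) bool :=
  tens_lift (overlap_bihom X).

Lemma Pfin_cpE X (U U' : Pfin X) : Pfin_cp X (pure _ _ U U') = (U `&` U' != fset0).
Proof. exact: tens_liftE. Qed.

Program Definition Pfin_cluster : cluster Pfin_display Type :=
  @Cluster _ Type (fun X => Pfin X : bJoinSemilatticeType _) Pfin_cp _ _.
Next Obligation.
by apply: tens_homP => U V; rewrite !tensE !Pfin_cpE fsetIC.
Qed.
Next Obligation.
move: i d' Z f g H => X d' Z f g fg; apply: jhomP => z.
apply/fsetP => x.
have /(congr1 (fun h => jfun h (pure _ _ z ([fset x] : Pfin X)))) := fg.
rewrite !tensE !Pfin_cpE.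
have E (U : {fset {classic X}}) : (U `&` [fset x] != fset0) = (x \in U).
  by apply/overlapP/idP => [[y yU /fset1P <-]//|xU]; exists x => //; apply/fset1P.
by rewrite !E.
Qed.

Definition bifinite (X Y : Type) (r : set (X * Y)) : Prop :=
  forall (x : X) (y : Y),
    finite_set [set z | r (x, z)] /\ finite_set [set w | r (w, y)].

Lemma bifinite_image X Y (r : set (X * Y)) x :
  bifinite r -> finite_set [set z | r (x, z)].
Proof.
move=> rfin; have [[y _]|nex] := pselect (exists y, r (x, y)).
  exact: (rfin x y).1.
by rewrite (_ : mkset _ = set0) // -subset0 => y rxy; apply: nex; exists y.
Qed.

Lemma bifinite_preimage X Y (r : set (X * Y)) y :
  bifinite r -> finite_set [set w | r (w, y)].
Proof.
move=> rfin; have [[x _]|nex] := pselect (exists x, r (x, y)).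
  exact: (rfin x y).2.
by rewrite (_ : mkset _ = set0) // -subset0 => x rxy; apply: nex; exists x.
Qed.

Definition bifrel (X Y : Type) : Type := {r : set (X * Y) | bifinite r}.

Lemma bifrelP X Y (r s : bifrel X Y) : proj1_sig r = proj1_sig s -> r = s.
Proof.
case: r s => r hr [s hs] /= rs.
by subst s; congr exist; exact: Prop_irrelevance.
Qed.

Lemma bifinite_id X : bifinite (@diagonal X).
Proof.
move=> x y; split.
  by apply: sub_finite_set (finite_set1 x) => z /diagonalP.
by apply: sub_finite_set (finite_set1 y) => z /diagonalP.
Qed.

Definition bifrel_id X : bifrel X X := exist _ (@diagonal X) (@bifinite_id X).

Lemma bifinite_comp X Y Z (s : bifrel Y Z) (r : bifrel X Y) :
  bifinite (proj1_sig s \; proj1_sig r)%relation.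
Proof.
case: s r => s sfin [r rfin] x z /=; split.
  apply: (@sub_finite_set _ _
    (\bigcup_(y in [set y | r (x, y)]) [set z | s (y, z)])) => [t [y]|].
    by exists y.
  apply: bigcup_finite => [|y _]; first exact: bifinite_image.
  exact: bifinite_image.
apply: (@sub_finite_set _ _
  (\bigcup_(y in [set y | s (y, z)]) [set w | r (w, y)])) => [t [y]|].
  by exists y.
apply: bigcup_finite => [|y _]; first exact: bifinite_preimage.
exact: bifinite_preimage.
Qed.

(* The library's relational composite s \; r relates x to z when r (x, y) and
   s (y, z) for some y, i.e. it is read as "s after r". *)
Definition bifrel_comp X Y Z (s : bifrel Y Z) (r : bifrel X Y) : bifrel X Z :=
  exist _ (proj1_sig s \; proj1_sig r)%relation (bifinite_comp s r).

Lemma bifinite_dag X Y (r : bifrel X Y) : bifinite (proj1_sig r)^-1%relation.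
Proof. by case: r => r rfin x y; have [] := rfin y x. Qed.

Definition bifrel_dag X Y (r : bifrel X Y) : bifrel Y X :=
  exist _ (proj1_sig r)^-1%relation (bifinite_dag r).

Program Definition BifRel : dagger_cat Type :=
  @DaggerCat Type bifrel bifrel_id bifrel_comp bifrel_dag _ _ _ _ _ _.
Next Obligation.
apply: bifrelP; apply/seteqP; split=> -[x w] /=.
  by move=> [z [y xy yz] zw]; exists y => //; exists z.
by move=> [y xy [z yz zw]]; exists z => //; exists y.
Qed.
Next Obligation.
apply: bifrelP; apply/seteqP; split=> -[x y] /=.
  by move=> [z xz /diagonalP <-].
by exists y => //; apply/diagonalP.
Qed.
Next Obligation.
apply: bifrelP; apply/seteqP; split=> -[x y] /=.
  by move=> [z /diagonalP <-].
by exists x => //; apply/diagonalP.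
Qed.
Next Obligation. by apply: bifrelP; apply/seteqP; split=> -[x y]. Qed.
Next Obligation.
by apply: bifrelP; apply/seteqP; split=> -[z x] /= [y ? ?]; exists y.
Qed.
Next Obligation. by apply: bifrelP; apply/seteqP; split=> -[x y]. Qed.

(* Main.v *)
(** A join-preserving map out of [Pfin X] is determined by its values on
    singletons.  Hence every map [t : Pfin X ⊗ Pfin Y -> 2] is [hat r] for the
    relation [r] that it induces on pairs of singletons.  Tested against
    singletons, the factorization [cp (lower t U) V = t (U ⊗ V)] says that
    [lower t [fset x]] has exactly the elements [y] with [r (x, y)], and
    symmetrically for [upper]; so tameness makes [r] bifinite.  Conversely, the
    images and preimages of points under a bifinite [r] extend freely to the two
    maps required for [hat r] to be tame. *)
Require Import Defs.
From mathcomp Require Import all_boot all_order finmap.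
From mathcomp Require Import boolp classical_sets functions cardinality.

Set Implicit Arguments.
Unset Strict Implicit.
Unset Printing Implicit Defensive.

Local Open Scope classical_set_scope.

(** Each law for [G] follows from that of [F] by writing the arguments as [F]-images and cancelling.
    So functoriality of the correspondence has to be checked in one direction only. *)
Lemma dagger_functor_inverse (Ob : Type) (C D : dagger_cat Ob)
  (F : dagger_functor C D) (G : forall X Y, D X Y -> C X Y) :
  (forall X Y (f : C X Y), G X Y (F X Y f) = f) ->
  (forall X Y (g : D X Y), F X Y (G X Y g) = g) ->
  exists G' : dagger_functor D C, forall X Y (g : D X Y), G' X Y g = G X Y g.
Proof.
move=> FK GK.
have G1 X : G X X (idm D X) = idm C X by rewrite -(fmap1 F) FK.
have Gcomp X Y Z (g : D Y Z) (f : D X Y) :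
    G X Z (Defs.comp g f) = Defs.comp (G Y Z g) (G X Y f).
  by rewrite -{1}[g]GK -{1}[f]GK -(fmap_comp F) FK.
have Gdag X Y (f : D X Y) : G Y X (dag f) = dag (G X Y f).
  by rewrite -{1}[f]GK -(fmap_dag F) FK.
by exists (DaggerFunctor G1 Gcomp Gdag).
Qed.

(** * Finite subsets and free extensions *)

Lemma finite_set_Pfin (X : Type) (A : set X) :
  finite_set A -> exists U : Pfin X, A = [set` U].
Proof. by move=> /(@finite_fsetP {classic X}). Qed.

(** Choice turns the pointwise finite images and preimages into functions, from which [tame_hat]
    later builds its two witnesses. *)
Lemma bifinite_factors (X Y : Type) (r : set (X * Y)) : bifinite r ->
  (exists f : X -> Pfin Y, forall x : X, [set y | r (x, y)] = [set` f x]) /\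
  (exists g : Y -> Pfin X, forall y : Y, [set x | r (x, y)] = [set` g y]).
Proof.
move=> rfin; split.
  have /choice[f fE] : forall x, exists U : Pfin Y,
      [set y | r (x, y)] = [set` U].
    by move=> x; exact/finite_set_Pfin/bifinite_image.
  by exists f.
have /choice[g gE] : forall y, exists U : Pfin X,
    [set x | r (x, y)] = [set` U].
  by move=> y; exact/finite_set_Pfin/bifinite_preimage.
by exists g.
Qed.

(** Existence half of the freeness of [Pfin X]; the extension is the union of the [f x] over [x] in
    [U]. *)
Lemma Pfin_extension (X Y : Type) (f : X -> Pfin Y) :
  exists h : jhom (Pfin X) (Pfin Y), forall (U : Pfin X) (y : Y),
    (y : {classic Y}) \in h U <->
    exists2 x : X, (x : {classic X}) \in U & (y : {classic Y}) \in f x.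
Proof.
pose h (U : Pfin X) : Pfin Y :=
  (\bigcup_(x <- (U : {fset {classic X}})) (f x : {fset {classic Y}}))%fset.
have hP (U : Pfin X) (y : Y) : (y : {classic Y}) \in h U <->
    exists2 x : X, (x : {classic X}) \in U & (y : {classic Y}) \in f x.
  split=> [/bigfcupP[x /andP[xU _] yfx]|[x xU yfx]]; first by exists x.
  by apply/bigfcupP; exists x; rewrite ?xU.
have h0 : h \bot%O = \bot%O by rewrite /h big_seq_fset0.
have hU (U V : Pfin X) : h (U `|` V)%O = (h U `|` h V)%O.
  apply/fsetP => y; apply/idP/idP.
    by move=> /hP[x]; rewrite !inE => /orP[xU|xV] yfx; apply/orP; [left|right];
      apply/hP; exists x.
  by rewrite inE => /orP[] /hP[x xU yfx]; apply/hP; exists x;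
    rewrite // inE xU ?orbT.
by exists (JHom h0 hU).
Qed.

(** * Maps from the tensor to the unit as relations *)

Lemma hatP (X Y : Type) (r : set (X * Y)) (U : Pfin X) (V : Pfin Y) :
  reflect (exists x y, [/\ (x : {classic X}) \in U, (y : {classic Y}) \in V
                         & r (x, y)])
          (hat r (pure _ _ U V)).
Proof. by apply: (iffP idP) => /hatE. Qed.

Definition Pfin1 (X : Type) (x : X) : Pfin X := [fset (x : {classic X})]%fset.

(** Induction on [U] as a finite join of singletons. Taking a bare function with two equations, not
    a [jhom], lets this apply to one argument of a pure tensor while the other is fixed. *)
Lemma bool_jhom_PfinP (X : Type) (h : Pfin X -> bool) :
  h \bot%O = false -> (forall U V, h (U `|` V)%O = h U || h V) ->
  forall U : Pfin X,
    h U <-> exists2 x : X, (x : {classic X}) \in U & h (Pfin1 x).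
Proof.
move=> h0 hU; elim/fset1U_rect=> [|x U _ IHU].
  (* The empty set is [\bot] only up to conversion, hence the explicit pattern. *)
  by split=> [|[]//]; rewrite [X in is_true X]h0.
rewrite [h _]hU; split=> [/orP[hx|/IHU[y yU hy]]|[y]].
- by exists x; rewrite ?fset1U1.
- by exists y; rewrite ?fset1Ur.
- by move=> /fset1UP[->->//|yU hy]; apply/orP; right; apply/IHU; exists y.
Qed.

(** Restriction to pairs of generators; this will be the inverse of [hat]. *)
Definition singleton_rel (X Y : Type) (t : jhom (Pfin X ⊗ Pfin Y) bool) :
    set (X * Y) :=
  [set p | t (pure _ _ (Pfin1 p.1) (Pfin1 p.2))].

Lemma singleton_rel_hat (X Y : Type) (r : set (X * Y)) :
  singleton_rel (hat r) = r.
Proof.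
apply/seteqP; split=> -[x y] /=.
  by move=> /hatP[x' [y' [/fset1P -> /fset1P ->]]].
by move=> rxy; apply/hatP; exists x, y; rewrite !fset11.
Qed.

(** Pure tensors suffice, and on them bilinearity allows [U] and then [V] to be decomposed into
    singletons. *)
Lemma hat_singleton_rel (X Y : Type) (t : jhom (Pfin X ⊗ Pfin Y) bool) :
  hat (singleton_rel t) = t.
Proof.
apply: tens_homP => U V; apply/idP/idP.
  move=> /hatP[x [y [xU yV txy]]].
  apply/(@bool_jhom_PfinP _ (fun U => t (pure _ _ U V))).
  - by rewrite bihom0l jhom0.
  - by move=> U1 U2; rewrite bihomUl jhomU.
  exists x => //; apply/(@bool_jhom_PfinP _ (fun V => t (pure _ _ _ V))).
  - by rewrite bihom0r jhom0.
  - by move=> V1 V2; rewrite bihomUr jhomU.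
  by exists y.
move=> /(@bool_jhom_PfinP _ (fun U => t (pure _ _ U V)))[||x xU].
- by rewrite bihom0l jhom0.
- by move=> U1 U2; rewrite bihomUl jhomU.
move=> /(@bool_jhom_PfinP _ (fun V => t (pure _ _ _ V)))[||y yV txy].
- by rewrite bihom0r jhom0.
- by move=> V1 V2; rewrite bihomUr jhomU.
by apply/hatP; exists x, y.
Qed.

(** * Tameness versus bifiniteness *)

Lemma Pfin_cp1r (X : Type) (U : Pfin X) (x : X) :
  Pfin_cp X (pure _ _ U (Pfin1 x)) = ((x : {classic X}) \in U).
Proof.
rewrite Pfin_cpE; apply/overlapP/idP => [[y yU /fset1P <-]//|xU].
by exists x; rewrite ?fset11.
Qed.

Lemma mem_lower (X Y : Type) (t : TRel Pfin_cluster X Y) (U : Pfin X) (y : Y) :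
  ((y : {classic Y}) \in (lower t U : Pfin Y)) =
  proj1_sig t (pure _ _ U (Pfin1 y)).
Proof. by rewrite -cp_lower [RHS]Pfin_cp1r. Qed.

Lemma mem_upper (X Y : Type) (t : TRel Pfin_cluster X Y) (V : Pfin Y) (x : X) :
  ((x : {classic X}) \in (upper t V : Pfin X)) =
  proj1_sig t (pure _ _ (Pfin1 x) V).
Proof. by rewrite -cp_upper cp_symE [RHS]Pfin_cp1r. Qed.

(** With [rl] the direct image and [ru] the inverse image under [r], both overlap conditions say
    that [r] meets the product of [U] and [V]. *)
Lemma tame_hat (X Y : Type) (r : set (X * Y)) :
  bifinite r -> tame (K := Pfin_cluster) (i := X) (j := Y) (hat r).
Proof.
move=> /bifinite_factors[[f rf] [g rg]].
have [rl rlP] := Pfin_extension f; have [ru ruP] := Pfin_extension g.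
have fE x y : (y : {classic Y}) \in f x <-> r (x, y).
  by rewrite [r _](_ : _ = [set y | r (x, y)] y) // rf.
have gE x y : (x : {classic X}) \in g y <-> r (x, y).
  by rewrite [r _](_ : _ = [set x | r (x, y)] x) // rg.
exists rl, ru; split; apply: tens_homP => U V; rewrite !tensE.
  rewrite [LHS]Pfin_cpE; apply/overlapP/hatP => [[y]|[x [y [xU yV rxy]]]].
    by move=> /rlP[x xU /fE rxy] yV; exists x, y.
  by exists y => //; apply/rlP; exists x => //; apply/fE.
rewrite [RHS]Pfin_cpE; apply/hatP/overlapP => [[x [y [xU yV rxy]]]|[x xU]].
  by exists x => //; apply/ruP; exists y => //; apply/gE.
by move=> /ruP[y yV /gE rxy]; exists x, y.
Qed.

(** Images and preimages of points lie in values of [lower t] and [upper t], which are finite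
    sets. *)
Lemma bifinite_singleton_rel (X Y : Type) (t : TRel Pfin_cluster X Y) :
  bifinite (singleton_rel (proj1_sig t)).
Proof.
move=> x y; split.
  apply: (@sub_finite_set _ _ [set` (lower t (Pfin1 x) : Pfin Y)]).
    by move=> z; rewrite /= mem_lower.
  exact: finite_fset.
apply: (@sub_finite_set _ _ [set` (upper t (Pfin1 y) : Pfin X)]).
  by move=> w; rewrite /= mem_upper.
exact: finite_fset.
Qed.

(** * The isomorphism of dagger categories *)

Definition hat_trel (X Y : Type) (r : BifRel X Y) : TRel Pfin_cluster X Y :=
  exist _ (hat (proj1_sig r)) (tame_hat (proj2_sig r)).

Definition singleton_bifrel (X Y : Type) (t : TRel Pfin_cluster X Y) :
    BifRel X Y :=
  exist _ (singleton_rel (proj1_sig t)) (bifinite_singleton_rel t).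

Lemma hat_trelK (X Y : Type) (r : BifRel X Y) :
  singleton_bifrel (hat_trel r) = r.
Proof. exact/bifrelP/singleton_rel_hat. Qed.

Lemma singleton_bifrelK (X Y : Type) (t : TRel Pfin_cluster X Y) :
  hat_trel (singleton_bifrel t) = t.
Proof.
by apply: trelP => U V; rewrite [proj1_sig (hat_trel _)]hat_singleton_rel.
Qed.

Lemma hat_trel_id (X : Type) :
  hat_trel (idm BifRel X) = idm (TRel Pfin_cluster) X.
Proof.
apply: trelP => U V; rewrite /= [RHS]Pfin_cpE; apply/hatP/overlapP.
  by move=> [x [y [xU yV /diagonalP xy]]]; exists x => //; rewrite xy.
by move=> [x xU xV]; exists x, x; split=> //; apply/diagonalP.
Qed.

Lemma hat_trel_comp (X Y Z : Type) (s : BifRel Y Z) (r : BifRel X Y) :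
  hat_trel (Defs.comp s r) = Defs.comp (hat_trel s) (hat_trel r).
Proof.
(* [lower] comes from choice and is known only through its factorization; testing on singletons
   identifies it as the direct image under [r], which supplies the middle point of the composite. *)
have lowerP (U : Pfin X) (y : Y) :
    (y : {classic Y}) \in (lower (hat_trel r) U : Pfin Y) <->
    exists2 x : X, (x : {classic X}) \in U & proj1_sig r (x, y).
  rewrite mem_lower; split=> [/hatP[x [y' [xU /fset1P -> rxy]]]|[x xU rxy]].
    by exists x.
  by apply/hatP; exists x, y; rewrite fset11.
apply: trelP => U V; rewrite [RHS]trel_compE; apply/hatP/hatP.
  move=> [x [z [xU zV [y rxy syz]]]]; exists y, z; split=> //.
  by apply/lowerP; exists x.
by move=> [y [z [/lowerP[x xU rxy] zV syz]]]; exists x, z; split=> //; exists y.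
Qed.

Lemma hat_trel_dag (X Y : Type) (r : BifRel X Y) :
  hat_trel (dag r) = dag (hat_trel r).
Proof.
apply: trelP => V U; rewrite [RHS]trel_dagE; apply/hatP/hatP.
  by move=> [y [x [yV xU rxy]]]; exists x, y.
by move=> [x [y [xU yV rxy]]]; exists y, x.
Qed.

Definition hat_functor : dagger_functor BifRel (TRel Pfin_cluster) :=
  DaggerFunctor hat_trel_id hat_trel_comp hat_trel_dag.

Theorem proposition4p2 :
  (exists (F : dagger_functor BifRel (TRel Pfin_cluster))
          (G : dagger_functor (TRel Pfin_cluster) BifRel),
    [/\ forall (X Y : Type) (r : BifRel X Y), G X Y (F X Y r) = r,
        forall (X Y : Type) (t : TRel Pfin_cluster X Y), F X Y (G X Y t) = t
      & forall (X Y : Type) (r : BifRel X Y),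
          proj1_sig (F X Y r) = hat (proj1_sig r)]) /\
  (forall (X Y : Type) (r : set (X * Y)), bifinite r ->
    (exists f : X -> Pfin Y, forall x : X, [set y | r (x, y)] = [set` f x]) /\
    (exists g : Y -> Pfin X, forall y : Y, [set x | r (x, y)] = [set` g y])).
Proof.
split; last exact: bifinite_factors.
(* [G] acts as [singleton_bifrel], so [GE] reduces both inverse laws to those already shown on
   morphisms. *)
have [G GE] := dagger_functor_inverse (F := hat_functor) hat_trelK
  singleton_bifrelK.
exists hat_functor, G; split=> // X Y => [r|t]; rewrite GE.
  exact: hat_trelK.
exact: singleton_bifrelK.
Qed.
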